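(* Let $k$ be a field, $Q$ a finite connected quiver without oriented cycles with vertex set $Q_0$ and arrow set $Q_1$. Let $Z$ be a minimal set of paths of length at least $2$, and let $B$ be the set of paths of $Q$ (including vertices) which do not contain any path of $Z$. Then $$\dim_k H^1\big(kQ/\langle Z\rangle,\,kQ/\langle Z\rangle\big)=1-|Q_0|+|(Q_1/\!/B)_{ne}|.$$
   Context: $kQ$ is the path algebra of $Q$ and $\langle Z\rangle$ the two-sided ideal generated by $Z$; $H^1(\Lambda,\Lambda)$ is the first Hochschild cohomology (derivations modulo inner derivations). $Z$ is minimal means that no path in $Z$ has a strict sub-path belonging to $Z$. The set $B$ is a basis of $kQ/\langle Z\rangle$. Define $Q_1/\!/B=\{(a,\varepsilon)\in Q_1\times B\mid s(\varepsilon)=s(a),\ t(\varepsilon)=t(a)\}$ (pairs of parallel arrow and path). A pair $(a,\varepsilon)\in Q_1/\!/B$ is glued if $a$ is the first or the last arrow of $\varepsilon$, or if $a$ is a loop and $\varepsilon$ is the vertex of that loop. A pair $(a,\varepsilon)$ is effective if (1) it is not glued, and (2) there exists a path $\gamma\in Z$ containing $a$ such that replacing $a$ by $\varepsilon$ inside $\gamma$ yields a path belonging to $B$. $(Q_1/\!/B)_{ne}$ denotes the set of elements of $Q_1/\!/B$ which are not effective. *)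

(* Defs.v *)
From HB Require Import structures.
From mathcomp Require Import all_boot all_order all_algebra.
Set Implicit Arguments. Unset Strict Implicit. Unset Printing Implicit Defensive.
Import GRing.Theory.
Local Open Scope ring_scope.

(* A quiver: finite vertex type Q0, finite arrow type Q1, source s, target t.
   A path is a pair (v, w) : Q0 * seq Q1, where v is its source vertex and
   w its sequence of arrows, read left to right (first arrow first);
   (v, [::]) is the trivial path at v. *)

Section Quiver.
Variables (Q0 Q1 : finType) (s t : Q1 -> Q0).

Fixpoint okp (v : Q0) (w : seq Q1) : bool :=
  if w is a :: w' then (s a == v) && okp (t a) w' else true.

Fixpoint tgtp (v : Q0) (w : seq Q1) : Q0 :=
  if w is a :: w' then tgtp (t a) w' else v.

Definition is_path (p : Q0 * seq Q1) : bool := okp p.1 p.2.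

Definition is_arrow_path (w : seq Q1) : bool :=
  if w is a :: _ then okp (s a) w else false.

Definition acyclic : Prop :=
  forall v w, okp v w -> w != [::] -> tgtp v w != v.

Definition qadj : rel Q0 :=
  fun x y => [exists a, ((s a == x) && (t a == y)) || ((s a == y) && (t a == x))].
Definition connected_quiver : Prop := forall x y, connect qadj x y.

Fixpoint words (n : nat) : seq (seq Q1) :=
  if n is n'.+1 then [::] :: [seq a :: w | a <- enum Q1, w <- words n']
  else [:: [::]].

Variable Z : seq (seq Q1).

Definition minimal_rel : Prop :=
  forall z z', z \in Z -> z' \in Z -> infix z' z -> z' = z.

Definition containsZ (w : seq Q1) : bool := has (fun z => infix z w) Z.

(* B: paths of Q (including vertices) not containing any path of Z.
   For an acyclic quiver every path has length < #|Q0|, so the enumeration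
   through [words #|Q0|] lists all of them. *)
Definition Bseq : seq (Q0 * seq Q1) :=
  undup [seq p <- [seq (v, w) | v <- enum Q0, w <- words #|Q0|]
         | is_path p && ~~ containsZ p.2].

Definition Bt := seq_sub Bseq.

Definition nB := #|{: Bt}|.

Section Algebra.
Variable k : fieldType.

(* Lambda = kQ/<Z>, realized on the basis B (row vectors indexed by B) *)
Definition Lam := 'rV[k]_nB.

Definition bvec (i : 'I_nB) : Lam := delta_mx 0 i.

(* product of two basis paths: the concatenation if composable and in B,
   0 otherwise (then it lies in <Z> or is 0 in kQ) *)
Definition bprod (i j : 'I_nB) : Lam :=
  let p := val (enum_val i) in
  let q := val (enum_val j) in
  if tgtp p.1 p.2 == q.1 then
    if @insub _ (fun x => x \in Bseq) Bt (p.1, p.2 ++ q.2) is Some r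
    then bvec (enum_rank r) else 0
  else 0.

Definition mulL (x y : Lam) : Lam :=
  \sum_(i < nB) \sum_(j < nB) (x 0 i * y 0 j) *: bprod i j.

Definition isDer (f : 'End(Lam)) : Prop :=
  forall x y, f (mulL x y) = mulL (f x) y + mulL x (f y).

Definition is_inner (f : 'End(Lam)) : Prop :=
  exists a : Lam, forall x, f x = mulL a x - mulL x a.

End Algebra.

Definition parallel (x : Q1 * Bt) : bool :=
  let: (a, e) := x in
  ((val e).1 == s a) && (tgtp (val e).1 (val e).2 == t a).

Definition glued (x : Q1 * Bt) : bool :=
  let: (a, e) := x in
  let w := (val e).2 in
  ((w != [::]) && ((head a w == a) || (last a w == a)))
  || ((s a == t a) && (w == [::]) && ((val e).1 == s a)).

Definition effective (x : Q1 * Bt) : bool :=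
  let: (a, e) := x in
  ~~ glued x &&
  has (fun g => has (fun i => (nth a g i == a) &&
         ((s (head a g), take i g ++ (val e).2 ++ drop i.+1 g) \in Bseq))
       (iota 0 (size g))) Z.

Definition ne_pairs : {set Q1 * Bt} :=
  [set x | parallel x && ~~ effective x].

End Quiver.

(* Main.v *)
Require Import Defs.
From HB Require Import structures.
From mathcomp Require Import all_boot all_order all_algebra zify.

Set Implicit Arguments. Unset Strict Implicit. Unset Printing Implicit Defensive.
Import GRing.Theory.
Local Open Scope ring_scope.

(* Modulo inner derivations every derivation kills the vertices, hence is
   determined by its values on arrows, which are combinations of parallel paths
   of B; conversely such values extend by the Leibniz rule iff the extension
   kills every z in Z. Without oriented cycles, replacing different arrows of z,
   or one arrow by different paths, yields different paths (unless the result is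
   z itself), so this condition says exactly that the coefficients of the
   effective pairs vanish. Hence the derivations [ad p], for p in B of positive
   length, and those attached to the non-effective pairs form a basis of
   Der(Lambda), of cardinality |B| - |Q0| + |(Q1//B)_ne|; and Inn(Lambda) has
   dimension |B| - 1, because the center of Lambda is k when Q is connected. *)

(** * Dimension of the span of an independent family *)

Lemma dim_span_image (K : fieldType) (vT : vectType K) (J : finType)
    (P : {pred J}) (F : J -> vT) :
  (forall c : J -> K, \sum_(j in P) c j *: F j = 0 -> forall j, j \in P -> c j = 0) ->
  \dim <<image F P>>%VS = #|P|.
Proof.
move=> indep; suff /eqP-> : free (image F P) by rewrite size_image.
apply/(freeP (X := image_tuple F P)) => c sum0 i.
(* Carries coefficients from positions in the enumeration of [P] over to [J]; the sum has at most
   one term because [enum_val] is injective. *)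
pose c' j := \sum_(i' | enum_val i' == j) c i'.
have c'E i' : c' (enum_val i' : J) = c i'.
  by rewrite /c' (eq_bigl (pred1 i')) ?big_pred1_eq // => x; exact: (inj_eq enum_val_inj).
rewrite -c'E; apply: indep (enum_valP i).
rewrite big_enum_val -[RHS]sum0; apply: eq_bigr => j _.
by rewrite c'E /= nth_image.
Qed.

(** * Paths in an acyclic quiver, and replacement of one arrow *)

Section Paths.
Variables (Q0 Q1 : finType) (s t : Q1 -> Q0).

Lemma okp_cat v w1 w2 : okp s t v (w1 ++ w2) = okp s t v w1 && okp s t (tgtp t v w1) w2.
Proof. by elim: w1 v => //= a w1 IH v; rewrite IH andbA. Qed.

Lemma tgtp_cat v w1 w2 : tgtp t v (w1 ++ w2) = tgtp t (tgtp t v w1) w2.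
Proof. by elim: w1 v => /=. Qed.

Lemma mem_words n (w : seq Q1) : (w \in words Q1 n) = (size w <= n)%N.
Proof.
elim: n w => [|n IH] [|a w] //=; rewrite inE /=.
apply/allpairsP/idP => [[[b u] /= [_ uw [_ ->]]]|sw]; first by rewrite ltnS -IH.
by exists (a, w); rewrite mem_enum IH.
Qed.

Hypothesis acy : acyclic s t.

Lemma loop_nil v w : okp s t v w -> tgtp t v w = v -> w = [::].
Proof. by move=> ok lp; case: eqP (acy ok) => // _ /(_ isT); rewrite lp eqxx. Qed.

(** A return to [v] would close an oriented cycle formed by an initial segment of [w]. *)
Lemma target_notin v w : okp s t v w -> v \notin map t w.
Proof.
move=> ok; apply/mapP => -[b bw vb].
case/splitPr: bw ok => u1 u2; rewrite -cat_rcons okp_cat => /andP[ok _].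
have /(loop_nil ok) : tgtp t v (rcons u1 b) = v by rewrite -cats1 tgtp_cat.
by case: u1 {ok}.
Qed.

Lemma size_path v w : okp s t v w -> (size w < #|Q0|)%N.
Proof.
move=> ok; have uq : uniq (v :: map t w).
  elim: w v ok => [|a w IH] v // ok; have := target_notin ok.
  by case/andP: ok => _ /IH /= -> ->.
by have := max_card (mem (v :: map t w)); rewrite (card_uniqP uq) /= size_map.
Qed.

(** One prefix extends the other, and the extension is a closed path at the common end, hence
    empty. *)
Lemma prefix_eq v p1 q1 p2 q2 : okp s t v p1 -> okp s t v p2 ->
  p1 ++ q1 = p2 ++ q2 -> tgtp t v p1 = tgtp t v p2 -> p1 = p2.
Proof.
elim: p1 p2 v => [|a p1 IH] [|b p2] v //=.
- by move=> _ ok _ e; rewrite (@loop_nil v (b :: p2)).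
- by move=> ok _ _ e; rewrite (@loop_nil v (a :: p1)).
move=> /andP[_ ok1] /andP[_ ok2] [ab e] et; subst b.
by rewrite (IH _ (t a) ok1 ok2 e et).
Qed.

Definition replw (w : seq Q1) (j : nat) (u : seq Q1) := take j w ++ u ++ drop j.+1 w.

Lemma replw_nth x0 w j : (j < size w)%N -> replw w j [:: nth x0 w j] = w.
Proof. by move=> jw; rewrite /replw /= -drop_nth // cat_take_drop. Qed.

(* The vertex [t (nth x0 w j)] occurs only once along the common word. *)
Lemma replw_eq_lt x0 v w j i u u0 : okp s t v w -> (j < i < size w)%N ->
  okp s t (s (nth x0 w j)) u -> tgtp t (s (nth x0 w j)) u = t (nth x0 w j) ->
  replw w j u = replw w i u0 -> u = [:: nth x0 w j].
Proof.
move=> okw /andP[ji iw] oku tu.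
have jw := ltn_trans ji iw.
rewrite /replw -(cat_take_drop j (take i w)) take_takel ?(ltnW ji) // -catA.
move/eqP; rewrite eqseq_cat // eqxx /= => /eqP.
rewrite (@drop_nth _ x0 j (take i w)); last by rewrite size_take iw.
rewrite nth_take // => e.
apply: (@prefix_eq (s (nth x0 w j)) _ (drop j.+1 w) _ (drop j.+1 (take i w) ++ u0 ++ drop i.+1 w)) => //=.
by rewrite eqxx.
Qed.

(** At different positions, the replacement at the smaller one is forced to be the original arrow,
    so the result is [w], which is excluded. At equal positions, cancellation suffices. *)
Lemma replw_inj x0 v w j i u u0 : okp s t v w -> (j < size w)%N -> (i < size w)%N ->
  okp s t (s (nth x0 w j)) u -> tgtp t (s (nth x0 w j)) u = t (nth x0 w j) ->
  okp s t (s (nth x0 w i)) u0 -> tgtp t (s (nth x0 w i)) u0 = t (nth x0 w i) ->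
  replw w j u = replw w i u0 -> replw w i u0 <> w -> j = i /\ u = u0.
Proof.
move=> okw jw iw oku tu oku0 tu0 e ne.
case: (ltngtP j i) => [ji|ij|ji].
- case: ne; rewrite -e (replw_eq_lt okw _ oku tu e) ?ji ?iw //.
  exact: replw_nth.
- case: ne; rewrite (replw_eq_lt okw _ oku0 tu0 (esym e)) ?ij ?jw //.
  exact: replw_nth.
split=> //; move: (congr1 size e) (e); rewrite ji /replw !size_cat.
move/addnI/addIn=> sz /eqP; rewrite eqseq_cat // eqxx eqseq_cat //=.
by case/andP=> /eqP.
Qed.
End Paths.

(** * Linear maps prescribed on the standard basis *)

Section LinearExtension.
Variables (k : fieldType) (n : nat) (vT : vectType k) (F : 'I_n -> vT).

Definition lin_ext_fun (x : 'rV[k]_n) : vT := \sum_i x 0 i *: F i.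

Fact lin_ext_fun_linear : linear lin_ext_fun.
Proof.
move=> c x y; rewrite /lin_ext_fun scaler_sumr -big_split; apply: eq_bigr => i _.
by rewrite !mxE scalerDl scalerA.
Qed.
HB.instance Definition _ :=
  GRing.isLinear.Build k 'rV[k]_n vT _ lin_ext_fun lin_ext_fun_linear.

Definition lin_ext : 'Hom('rV[k]_n, vT) := linfun lin_ext_fun.

Lemma lin_extE x : lin_ext x = \sum_i x 0 i *: F i.
Proof. exact: lfunE. Qed.

Lemma lin_ext_delta i : lin_ext (delta_mx 0 i) = F i.
Proof.
rewrite lin_extE (bigD1 i) //= mxE !eqxx scale1r big1 ?addr0 // => j ji.
by rewrite mxE (negPf ji) scale0r.
Qed.
End LinearExtension.

(** * The algebra in its basis of paths *)

Section Algebra.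
Variables (Q0 Q1 : finType) (s t : Q1 -> Q0) (Z : seq (seq Q1)) (k : fieldType).
Hypothesis acy : acyclic s t.

Local Notation Bs := (Defs.Bseq s t Z).
Local Notation n := (nB s t Z).
Local Notation Lam := (Lam s t Z k).
Local Notation bvec := (@bvec Q0 Q1 s t Z k).

Definition pth (i : 'I_n) : Q0 * seq Q1 := val (enum_val i).

(* Every pair [(v, w)] gets a vector: its class in kQ/<Z>, and [0] if it is
   not a path. *)
Definition pvec (p : Q0 * seq Q1) : Lam :=
  if @insub _ (fun x => x \in Bs) (Bt s t Z) p is Some r
  then bvec (enum_rank r) else 0.

(** By [size_path], the length bound built into [Bseq] holds for every path. *)
Lemma mem_Bseq p : (p \in Bs) = is_path s t p && ~~ containsZ Z p.2.
Proof.
rewrite mem_undup mem_filter; apply: andb_idr => /andP[ok _].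
apply/allpairsP; exists p; rewrite mem_enum mem_words; split=> //.
  exact: (ltnW (size_path acy ok)).
by case: p {ok}.
Qed.

Lemma pth_inj : injective pth.
Proof. by move=> i j /val_inj /enum_val_inj. Qed.

Lemma pth_mem i : pth i \in Bs.
Proof. exact: valP. Qed.

Lemma okp_pth i : okp s t (pth i).1 (pth i).2.
Proof. by have := pth_mem i; rewrite mem_Bseq => /andP[]. Qed.

Lemma pthP p : reflect (exists i, p = pth i) (p \in Bs).
Proof.
apply: (iffP idP) => [pB|[i ->]]; last exact: pth_mem.
by exists (enum_rank (Sub p pB : Bt s t Z)); rewrite /pth enum_rankK SubK.
Qed.

Lemma pvecE p i : pvec p 0 i = (p == pth i)%:R.
Proof.
rewrite /pvec; case: insubP => [r _ rp|pB]; last first.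
  by rewrite mxE; case: eqP => // e; move: pB; rewrite e pth_mem.
rewrite mxE eqxx /=; congr (nat_of_bool _)%:R.
apply/eqP/eqP => [->|pi]; first by rewrite /pth enum_rankK.
by apply: pth_inj; rewrite -pi /pth enum_rankK.
Qed.

Lemma pvec0 p : p \notin Bs -> pvec p = 0.
Proof. by rewrite /pvec; case: insubP => // r ->. Qed.

Lemma pvec_pth i : pvec (pth i) = bvec i.
Proof.
by apply/rowP => j; rewrite pvecE mxE eqxx (inj_eq pth_inj) eq_sym.
Qed.

Lemma Lam_sum (x : Lam) : x = \sum_i x 0 i *: pvec (pth i).
Proof.
rewrite [LHS]matrix_sum_delta big_ord1; apply: eq_bigr => i _.
by rewrite pvec_pth.
Qed.

Lemma lfun_ext (vT : vectType k) (f g : 'Hom(Lam, vT)) :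
  (forall i, f (pvec (pth i)) = g (pvec (pth i))) -> f = g.
Proof.
move=> fg; apply/lfunP => x; rewrite (Lam_sum x) !linear_sum.
by apply: eq_bigr => i _; rewrite !linearZ; congr (_ *: _); exact: fg.
Qed.

Local Notation mulL := (@mulL Q0 Q1 s t Z k).
Local Notation "x ** y" := (mulL x y) (at level 40, left associativity).

Fact mulL_linear x : linear (mulL x).
Proof.
move=> c y z; rewrite /Defs.mulL scaler_sumr -big_split; apply: eq_bigr => i _ /=.
rewrite scaler_sumr -big_split; apply: eq_bigr => j _ /=.
by rewrite !mxE mulrDr scalerDl scalerA mulrCA.
Qed.
HB.instance Definition _ x :=
  GRing.isLinear.Build k Lam Lam _ (mulL x) (mulL_linear x).

(** Arguments are swapped so that linearity in the left factor can be registered as a linear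
    structure. *)
Definition mulLr y x := x ** y.

Fact mulLr_linear y : linear (mulLr y).
Proof.
move=> c x z; rewrite /mulLr /Defs.mulL scaler_sumr -big_split; apply: eq_bigr => i _ /=.
rewrite scaler_sumr -big_split; apply: eq_bigr => j _ /=.
by rewrite !mxE mulrDl scalerDl scalerA mulrA.
Qed.
HB.instance Definition _ y :=
  GRing.isLinear.Build k Lam Lam _ (mulLr y) (mulLr_linear y).

Lemma mulL0 x : x ** 0 = 0. Proof. exact: linear0. Qed.
Lemma mul0L x : 0 ** x = 0. Proof. exact: (linear0 (mulLr x)). Qed.
Lemma mulLDr x y z : x ** (y + z) = x ** y + x ** z. Proof. exact: linearD. Qed.
Lemma mulLDl x y z : (y + z) ** x = y ** x + z ** x.
Proof. exact: (linearD (mulLr x)). Qed.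
Lemma mulLN x y : x ** (- y) = - (x ** y). Proof. exact: linearN. Qed.
Lemma mulNL x y : (- x) ** y = - (x ** y). Proof. exact: (linearN (mulLr y)). Qed.
Lemma mulLZr c x y : x ** (c *: y) = c *: (x ** y). Proof. exact: linearZ. Qed.
Lemma mulLZl c x y : (c *: y) ** x = c *: (y ** x).
Proof. exact: (linearZ_LR (mulLr x)). Qed.
Lemma mulL_sumr (I : Type) (r : seq I) (P : pred I) F x :
  x ** (\sum_(i <- r | P i) F i) = \sum_(i <- r | P i) x ** F i.
Proof. exact: linear_sum. Qed.
Lemma mulL_suml (I : Type) (r : seq I) (P : pred I) F x :
  (\sum_(i <- r | P i) F i) ** x = \sum_(i <- r | P i) F i ** x.
Proof. exact: (linear_sum (mulLr x)). Qed.

Lemma mulL_bvec i j : bvec i ** bvec j = bprod k i j.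
Proof.
rewrite /Defs.mulL (bigD1 i) //= [X in _ + X]big1 ?addr0; last first.
  move=> i' ii'; apply: big1 => j' _.
  by rewrite !mxE (negPf ii') andbF mul0r scale0r.
rewrite (bigD1 j) //= [X in _ + X]big1 ?addr0; last first.
  by move=> j' jj'; rewrite !mxE (negPf jj') andbF mulr0 scale0r.
by rewrite !mxE !eqxx mulr1 scale1r.
Qed.

Lemma mem_Bseq_cat p q : tgtp t p.1 p.2 = q.1 -> (p.1, p.2 ++ q.2) \in Bs ->
  (p \in Bs) && (q \in Bs).
Proof.
move=> pq; rewrite !mem_Bseq /is_path /= okp_cat pq => /andP[/andP[-> ->]] /= nZ.
apply/andP; split; apply: contraNN nZ => /hasP[z zZ zi]; apply/hasP; exists z => //.
  exact: infix_catr.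
exact: infix_catl.
Qed.

(** For factors in [B] this is [bprod]. If a factor lies outside [B], so does any composable
    concatenation, and both sides vanish. *)
Lemma mulL_pvec p q : pvec p ** pvec q =
  if tgtp t p.1 p.2 == q.1 then pvec (p.1, p.2 ++ q.2) else 0.
Proof.
have [pB|pB] := boolP (p \in Bs); last first.
  rewrite pvec0 // mul0L; case: eqP => // e; rewrite pvec0 //.
  by apply: contraNN pB => /(mem_Bseq_cat e) /andP[].
have [qB|qB] := boolP (q \in Bs); last first.
  rewrite (pvec0 qB) mulL0; case: eqP => // e; rewrite pvec0 //.
  by apply: contraNN qB => /(mem_Bseq_cat e) /andP[].
by case/pthP: pB => i ->; case/pthP: qB => j ->; rewrite !pvec_pth mulL_bvec.
Qed.

Lemma eq_linear_pvec (f g : {linear Lam -> Lam}) :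
  (forall i, f (pvec (pth i)) = g (pvec (pth i))) -> f =1 g.
Proof.
move=> fg x; rewrite (Lam_sum x) !linear_sum; apply: eq_bigr => i _.
by rewrite !linearZ_LR fg.
Qed.

Lemma mulLA x y z : x ** (y ** z) = x ** y ** z.
Proof.
move: x; apply: (@eq_linear_pvec (mulLr (y ** z)) (mulLr z \o mulLr y)) => i /=.
rewrite /mulLr; move: y.
apply: (@eq_linear_pvec (mulL (pvec (pth i)) \o mulLr z)
                        (mulLr z \o mulL (pvec (pth i)))) => j /=.
rewrite /mulLr; move: z.
apply: (@eq_linear_pvec (mulL (pvec (pth i)) \o mulL (pvec (pth j)))
                        (mulL (pvec (pth i) ** pvec (pth j)))) => l /=.
rewrite !mulL_pvec; case: eqP => e1; case: eqP => e2 /=;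
  rewrite ?mul0L ?mulL0 ?mulL_pvec /= ?tgtp_cat ?catA.
- by rewrite e2 e1 !eqxx.
- by case: eqP.
- by rewrite e2; case: eqP.
- by [].
Qed.

(** Vertices are idempotents acting diagonally in the basis [B]; identities involving them can thus
    be checked coordinate by coordinate. *)
Lemma mulL_vl v x i : (pvec (v, [::]) ** x) 0 i = x 0 i * ((pth i).1 == v)%:R.
Proof.
rewrite {1}(Lam_sum x) mulL_sumr summxE (bigD1 i) //= mulLZr mulL_pvec /= big1 ?addr0.
  rewrite mxE eq_sym; case: eqP => e; last by rewrite mxE.
  by rewrite -e pvecE -surjective_pairing eqxx.
move=> j ji; rewrite mulLZr mulL_pvec mxE /=; case: eqP => e; last by rewrite mxE mulr0.
by rewrite e -surjective_pairing pvecE (inj_eq pth_inj) (negPf ji) mulr0.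
Qed.

Lemma mulL_vr v x i :
  (x ** pvec (v, [::])) 0 i = x 0 i * (tgtp t (pth i).1 (pth i).2 == v)%:R.
Proof.
rewrite {1}(Lam_sum x) mulL_suml summxE (bigD1 i) //= mulLZl mulL_pvec /= big1 ?addr0.
  rewrite mxE cats0; case: eqP => e; last by rewrite mxE.
  by rewrite pvecE -surjective_pairing eqxx.
move=> j ji; rewrite mulLZl mulL_pvec mxE cats0 /=; case: eqP => e; last by rewrite mxE mulr0.
by rewrite -surjective_pairing pvecE (inj_eq pth_inj) (negPf ji) mulr0.
Qed.

(** * Leibniz extension of values given on arrows *)

Definition avec a := pvec (s a, [:: a]).

Lemma pvec_cons v a w : okp s t v (a :: w) -> pvec (v, a :: w) = avec a ** pvec (t a, w).
Proof. by case/andP=> /eqP <- _; rewrite mulL_pvec /= eqxx. Qed.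

Lemma pvec_cat v w1 w2 : pvec (v, w1 ++ w2) = pvec (v, w1) ** pvec (tgtp t v w1, w2).
Proof. by rewrite mulL_pvec eqxx. Qed.

Definition par i a := ((pth i).1 == s a) && (tgtp t (pth i).1 (pth i).2 == t a).

(* The possible values on arrows of a derivation killing all vertices. *)
Definition par_supported (beta : Q1 -> Lam) := forall a i, ~~ par i a -> beta a 0 i = 0.

Lemma par_supported_l beta a : par_supported beta -> pvec (s a, [::]) ** beta a = beta a.
Proof.
move=> sup; apply/rowP => i; rewrite mulL_vl.
by case: (boolP (par i a)) => [/andP[-> _]|/sup->]; rewrite ?mulr1 ?mul0r.
Qed.

Lemma par_supported_r beta a : par_supported beta -> beta a ** pvec (t a, [::]) = beta a.
Proof.
move=> sup; apply/rowP => i; rewrite mulL_vr.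
by case: (boolP (par i a)) => [/andP[_ ->]|/sup->]; rewrite ?mulr1 ?mul0r.
Qed.

(** The derivation from kQ to [Lam] that kills vertices and has values [beta] on arrows. No source
    vertex is needed: a nonempty path determines it, and trivial paths all go to [0]. *)
Fixpoint leib (beta : Q1 -> Lam) (w : seq Q1) : Lam :=
  if w is a :: w' then beta a ** pvec (t a, w') + avec a ** leib beta w' else 0.

Lemma leib_sum (I : finType) (P : pred I) (c : I -> k) (b : I -> Q1 -> Lam) beta w :
  (forall a, beta a = \sum_(x | P x) c x *: b x a) ->
  leib beta w = \sum_(x | P x) c x *: leib (b x) w.
Proof.
move=> bE; elim: w => [|a w IH] /=; first by rewrite big1 // => x _; rewrite scaler0.
rewrite IH bE mulL_suml mulL_sumr -big_split; apply: eq_bigr => x _.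
by rewrite mulLZl mulLZr scalerDr.
Qed.

Section Leib.
Variable beta : Q1 -> Lam.
Hypothesis sup : par_supported beta.

Lemma leib_l v w : okp s t v w -> pvec (v, [::]) ** leib beta w = leib beta w.
Proof.
case: w => [|a w] /=; first by rewrite mulL0.
case/andP=> /eqP <- _; rewrite mulLDr !mulLA par_supported_l //.
by congr (_ + _ ** _); rewrite mulL_pvec /= eqxx.
Qed.

Lemma leib_r v w : okp s t v w -> leib beta w ** pvec (tgtp t v w, [::]) = leib beta w.
Proof.
elim: w v => [|a w IH] v /=; first by rewrite mul0L.
case/andP=> _ ok; rewrite mulLDl -!mulLA IH //.
by congr (_ ** _ + _); rewrite mulL_pvec /= eqxx cats0.
Qed.

(** The words may contain elements of [Z]: this is the Leibniz rule on kQ, before passing to the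
    quotient. *)
Lemma leib_cat v w1 w2 : okp s t v (w1 ++ w2) -> leib beta (w1 ++ w2) =
  leib beta w1 ** pvec (tgtp t v w1, w2) + pvec (v, w1) ** leib beta w2.
Proof.
elim: w1 v => [|a w1 IH] v ok; first by rewrite mul0L add0r leib_l.
case/andP: (ok) => /eqP va ok'; rewrite /= (IH (t a)) //.
rewrite pvec_cat mulLDl mulLDr !mulLA -addrA; congr (_ + (_ + _)).
congr (_ ** _); rewrite mulL_pvec /= eqxx va //.
Qed.

(** Expands each [beta] value in the basis, so that the coefficients of [beta] appear in front of
    the words tested in [effective]. *)
Lemma leib_replw x0 v w : okp s t v w -> leib beta w =
  \sum_(j < size w) \sum_i beta (nth x0 w j) 0 i *: pvec (v, replw w j (pth i).2).
Proof.
elim: w v => [|a w IH] v ok; first by rewrite big_ord0.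
case/andP: (ok) => /eqP va ok'; rewrite /= big_ord_recl; congr (_ + _).
  rewrite /= {1}(Lam_sum (beta a)) mulL_suml; apply: eq_bigr => i _.
  rewrite mulLZl /replw /= drop0.
  (* Only parallel paths have a nonzero coefficient, and for these the concatenation is
     composable. *)
  case: (boolP (par i a)) => [/andP[/eqP e1 /eqP e2]|/sup->]; last by rewrite !scale0r.
  by rewrite mulL_pvec /= e2 eqxx e1 va.
rewrite (IH (t a)) // mulL_sumr; apply: eq_bigr => j _.
rewrite mulL_sumr; apply: eq_bigr => i _; rewrite mulLZr; congr (_ *: _).
by rewrite mulL_pvec /= eqxx va.
Qed.
End Leib.

(** * Derivations and inner derivations *)

Local Notation isDer := (@isDer Q0 Q1 s t Z k).

Lemma isDer_pvec (f : 'End(Lam)) :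
  (forall i j, f (pvec (pth i) ** pvec (pth j)) =
     f (pvec (pth i)) ** pvec (pth j) + pvec (pth i) ** f (pvec (pth j))) ->
  isDer f.
Proof.
move=> fM x y; move: x.
apply: (@eq_linear_pvec (f \o mulLr y) ((mulLr y \o f) \+ mulLr (f y))) => i /=.
rewrite /mulLr; move: y.
apply: (@eq_linear_pvec (f \o mulL (pvec (pth i)))
          (mulL (f (pvec (pth i))) \+ (mulL (pvec (pth i)) \o f))) => j.
exact: fM.
Qed.

Lemma isDer_comb (I : finType) (P : pred I) (c : I -> k) (F : I -> 'End(Lam)) :
  (forall i, P i -> isDer (F i)) -> isDer (\sum_(i | P i) c i *: F i).
Proof.
move=> FD; apply: (big_ind isDer) => [x y|f g fD gD x y|i /FD fD x y].
- by rewrite !lfunE /= mul0L mulL0 addr0.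
- by rewrite !add_lfunE fD gD mulLDl mulLDr addrACA.
- by rewrite !scale_lfunE fD mulLZl mulLZr scalerDr.
Qed.

Definition ad (x : Lam) : 'End(Lam) := lin_ext (fun i => x ** bvec i - bvec i ** x).

Lemma adE x y : ad x y = x ** y - y ** x.
Proof.
move: y; apply: (@eq_linear_pvec (ad x) (mulL x \- mulLr x)) => i.
by rewrite /= pvec_pth lin_ext_delta.
Qed.

Lemma isDer_ad x : isDer (ad x).
Proof.
move=> y z; rewrite !adE mulLDl mulLDr mulNL mulLN.
by rewrite !mulLA addrA addrNK.
Qed.

Lemma ad_vertex x v i : ad x (pvec (v, [::])) 0 i =
  x 0 i * ((tgtp t (pth i).1 (pth i).2 == v)%:R - ((pth i).1 == v)%:R).
Proof. by rewrite adE !mxE mulL_vl mulL_vr mulrBr. Qed.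

(** [ad] as a linear map, with the inner derivations as image and the center as kernel. *)
Definition adL : 'Hom(Lam, 'End(Lam)) := lin_ext (fun i => ad (pvec (pth i))).

Lemma adLE x : adL x = ad x.
Proof.
apply/lfunP => y; rewrite lin_extE sum_lfunE adE.
rewrite -[RHS]/((mulLr y \- mulL y) x) {2}(Lam_sum x) linear_sum.
by apply: eq_bigr => i _; rewrite scale_lfunE adE linearZ_LR.
Qed.

Lemma tgt_pth i : (pth i).2 != [::] -> ((pth i).1 == tgtp t (pth i).1 (pth i).2) = false.
Proof. by move=> i0; rewrite eq_sym; apply/negbTE/acy => //; exact: okp_pth. Qed.

(** Without oriented cycles the source of a nontrivial path differs from its target, so only one of
    the two terms of [ad_vertex] survives. Hence [ad x] determines [x] up to trivial paths. *)
Lemma ad_tgt x i : (pth i).2 != [::] ->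
  ad x (pvec (tgtp t (pth i).1 (pth i).2, [::])) 0 i = x 0 i.
Proof. by move=> i0; rewrite ad_vertex eqxx tgt_pth // subr0 mulr1. Qed.

(** * Identity, center, and dimension of the inner derivations *)

Hypothesis hZ : forall z, z \in Z -> is_arrow_path s t z && (2 <= size z)%N.

Lemma short_mem v w : okp s t v w -> (size w < 2)%N -> (v, w) \in Bs.
Proof.
move=> ok sw; rewrite mem_Bseq /is_path ok; apply/hasPn => z zZ.
apply: contraTN sw => /size_infix zw; rewrite -leqNgt.
by apply: leq_trans zw; case/andP: (hZ zZ).
Qed.

Lemma vertex_mem v : (v, [::]) \in Bs. Proof. exact: short_mem. Qed.

Lemma arrow_mem a : (s a, [:: a]) \in Bs.
Proof. by apply: short_mem; rewrite //= eqxx. Qed.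

Definition vidx v : 'I_n := enum_rank (Sub (v, [::]) (vertex_mem v) : Bt s t Z).

Lemma pth_vidx v : pth (vidx v) = (v, [::]).
Proof. by rewrite /pth enum_rankK SubK. Qed.

Lemma vidx_inj : injective vidx.
Proof. by move=> u v /(congr1 pth); rewrite !pth_vidx => -[]. Qed.

Lemma vidxP i : (pth i).2 = [::] -> i = vidx (pth i).1.
Proof. by move=> i0; apply: pth_inj; rewrite pth_vidx -i0 -surjective_pairing. Qed.

Lemma card_nontrivial : (#|[pred i | (pth i).2 != [::]]| + #|Q0|)%N = n.
Proof.
rewrite -(card_codom vidx_inj) -[RHS]card_ord -[RHS](cardC (mem (codom vidx))) addnC.
congr (_ + _)%N; apply: eq_card => i; rewrite !inE; congr (~~ _).
apply/eqP/codomP => [/vidxP->|[v ->]]; last by rewrite pth_vidx.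
by eexists.
Qed.

Lemma avec_neq0 a : avec a != 0.
Proof.
have /pthP[i ai] := arrow_mem a.
by apply/eqP => /rowP/(_ i)/eqP; rewrite pvecE ai eqxx mxE oner_eq0.
Qed.

Definition oneL : Lam := \sum_v pvec (v, [::]).

Lemma mul1L x : oneL ** x = x.
Proof.
apply/rowP => i; rewrite /oneL mulL_suml summxE.
rewrite (bigD1 (pth i).1) //= mulL_vl eqxx mulr1 big1 ?addr0 // => v vi.
by rewrite mulL_vl eq_sym (negPf vi) mulr0.
Qed.

Lemma mulL1 x : x ** oneL = x.
Proof.
apply/rowP => i; rewrite /oneL mulL_sumr summxE.
rewrite (bigD1 (tgtp t (pth i).1 (pth i).2)) //= mulL_vr eqxx mulr1 big1 ?addr0 // => v vi.
by rewrite mulL_vr eq_sym (negPf vi) mulr0.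
Qed.

Lemma vertex_sum (c : Q0 -> k) i : (\sum_v c v *: pvec (v, [::])) 0 i =
  if (pth i).2 == [::] then c (pth i).1 else 0.
Proof.
rewrite summxE; case: eqP => i0; last first.
  rewrite big1 // => v _; rewrite mxE pvecE; case: eqP => vi; last by rewrite mulr0.
  by case: i0; rewrite -vi.
rewrite (bigD1 (pth i).1) //= mxE pvecE -i0 -surjective_pairing eqxx mulr1.
rewrite big1 ?addr0 // => v vi; rewrite mxE pvecE.
by case: eqP => [e|]; [rewrite -e eqxx in vi | rewrite mulr0].
Qed.

Lemma oneL_neq0 : (0 < #|Q0|)%N -> oneL != 0.
Proof.
case/card_gt0P=> v _; apply/eqP => /rowP/(_ (vidx v))/eqP.
rewrite /oneL; under eq_bigr do rewrite -[pvec _]scale1r.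
by rewrite (vertex_sum (fun=> 1)) pth_vidx mxE oner_eq0.
Qed.

(** By [ad_tgt] a central element is a combination of vertices. Commutation with an arrow equates
    the coefficients at its two ends, and connectedness spreads the equality. *)
Lemma center_oneL x : connected_quiver s t -> ad x = 0 -> x \in <[oneL]>%VS.
Proof.
move=> con x0; pose c v := x 0 (vidx v).
have xE : x = \sum_v c v *: pvec (v, [::]).
  apply/rowP => i; rewrite vertex_sum; case: eqP => [/vidxP i0|/eqP i0].
    by rewrite {1}i0.
  by rewrite -(ad_tgt x i0) x0 lfunE mxE.
have c_arrow a : c (s a) = c (t a).
  have := adE x (avec a); rewrite x0 lfunE xE mulL_suml mulL_sumr /=.
  rewrite (bigD1 (s a)) //= [in X in _ = _ - X](bigD1 (t a)) //=.
  (* Only the source contributes to [x ** avec a], only the target to [avec a ** x]. *)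
  rewrite !big1 ?addr0; first last.
  - move=> v va; rewrite mulLZl mulL_pvec /= (negPf va) scaler0 //.
  - by move=> v va; rewrite mulLZr mulL_pvec /= eq_sym (negPf va) scaler0.
  rewrite mulLZl mulLZr !mulL_pvec /= !eqxx -scalerBl => /esym/eqP.
  by rewrite scaler_eq0 (negPf (avec_neq0 a)) orbF subr_eq0 => /eqP.
have c_const u v : c u = c v.
  case/connectP: (con u v) => p; elim: p u => [|w p IH] u /=; first by move=> _ ->.
  case/andP=> /existsP[a adj] /IH{}IH /IH <-.
  by case/orP: adj => /andP[/eqP <- /eqP <-]; rewrite c_arrow.
case: (pickP Q0) => [v0 _|no]; last by rewrite xE big1 ?mem0v // => v; have := no v.
apply/vlineP; exists (c v0); rewrite xE /oneL scaler_sumr; apply: eq_bigr => v _.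
by rewrite (c_const v v0).
Qed.

(** Rank-nullity for [adL], whose kernel is the line spanned by the identity. *)
Lemma dim_inner : (0 < #|Q0|)%N -> connected_quiver s t -> (\dim (limg adL)).+1 = n.
Proof.
move=> q0 con; have dL : \dim {:Lam} = n by rewrite dimvf /dim /= mul1n.
rewrite -[RHS]dL -(limg_ker_dim adL fullv).
rewrite capfv (_ : lker adL = <[oneL]>%VS) ?dim_vline ?oneL_neq0 //.
apply/vspaceP => x; rewrite memv_ker adLE; apply/eqP/idP; first exact: center_oneL.
case/vlineP=> c ->; apply/lfunP => y.
by rewrite adE lfunE mulLZl mulLZr mul1L mulL1 subrr.
Qed.

(** * Descent of the Leibniz extension to [Lam] *)

Lemma containsZ_pvec v w : containsZ Z w -> pvec (v, w) = 0.
Proof. by move=> wZ; rewrite pvec0 // mem_Bseq wZ andbF. Qed.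

Definition leibD (beta : Q1 -> Lam) : 'End(Lam) := lin_ext (fun i => leib beta (pth i).2).

Lemma leibD_pth beta i : leibD beta (pvec (pth i)) = leib beta (pth i).2.
Proof. by rewrite pvec_pth lin_ext_delta. Qed.

Section LeibD.
Variable beta : Q1 -> Lam.
Hypotheses (sup : par_supported beta) (betaZ : forall z, z \in Z -> leib beta z = 0).

(** Write the path as [u ++ z ++ u']. Terms differentiating [u] or [u'] keep the factor [z], which
    is zero in [Lam]; the term differentiating [z] vanishes by [betaZ]. *)
Lemma leib_containsZ v w : okp s t v w -> containsZ Z w -> leib beta w = 0.
Proof.
move=> ok /hasP[z zZ /infixP[u [u' wE]]]; move: ok; rewrite wE => ok.
rewrite (leib_cat sup ok) containsZ_pvec; last first.
  by apply/hasP; exists z => //; exact: infix_catr (infix_refl z).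
rewrite mulL0 add0r; case/andP: (etrans (esym (okp_cat s t v u (z ++ u'))) ok) => _ ok'.
rewrite (leib_cat sup ok') betaZ // mul0L add0r (@containsZ_pvec _ z) ?mul0L ?mulL0 //.
by apply/hasP; exists z => //; exact: infix_refl.
Qed.

Lemma leibD_pvec v w : okp s t v w -> leibD beta (pvec (v, w)) = leib beta w.
Proof.
move=> ok; have [/pthP[i e]|nB] := boolP ((v, w) \in Bs).
  by rewrite e leibD_pth -e.
have wZ : containsZ Z w by move: nB; rewrite mem_Bseq /is_path ok negbK.
by rewrite containsZ_pvec // linear0 (leib_containsZ ok).
Qed.

Lemma isDer_leibD : isDer (leibD beta).
Proof.
apply: isDer_pvec => i j; rewrite !leibD_pth mulL_pvec.
have oi := okp_pth i; have oj := okp_pth j.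
case: eqP => [e|/eqP e].
  have ok : okp s t (pth i).1 ((pth i).2 ++ (pth j).2) by rewrite okp_cat oi e.
  by rewrite leibD_pvec // (leib_cat sup ok) e -!surjective_pairing.
(* For non-composable paths, inserting the end vertices exhibits a zero product in each term. *)
rewrite linear0 -(leib_r beta oi) -(leib_l sup oj) -mulLA mulL_pvec /= (negPf e).
rewrite mulLA mulL_pvec /= (negPf e) mul0L mulL0 addr0 //.
Qed.
End LeibD.

(** * Derivations attached to non-effective pairs *)

Definition pair_val (x : Q1 * Bt s t Z) (b : Q1) : Lam :=
  if b == x.1 then pvec (val x.2) else 0.

Lemma pair_valE x b i : pair_val x b 0 i = ((b == x.1) && (val x.2 == pth i))%:R.
Proof. by rewrite /pair_val; case: eqP => _; rewrite ?pvecE ?mxE. Qed.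

Lemma pair_val_supported x : parallel x -> par_supported (pair_val x).
Proof.
case: x => a e pe b i; rewrite pair_valE /=; case: eqP => //= ->; case: eqP => // ei.
by rewrite /par -ei; move: pe; rewrite /parallel => ->.
Qed.

(** If the path starts or ends with [a], what remains of it is closed, hence empty; the loop case
    cannot occur in an acyclic quiver. *)
Lemma glued_parallel a (e : Bt s t Z) : parallel (a, e) -> glued (a, e) ->
  (val e).2 = [:: a].
Proof.
case: e => -[v w] /= eB; case/andP=> /eqP va /eqP te; simpl in va, te; subst v.
have ok : okp s t (s a) w by move: eB; rewrite mem_Bseq => /andP[].
rewrite /glued /=.
case/orP=> [/andP[w0 /orP[/eqP h|/eqP l]]|/andP[/andP[/eqP st _] _]].
- case: w w0 h te ok {eB} => //= b w _ -> te /andP[_ ok].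
  by rewrite (loop_nil acy ok te).
- case/lastP: w w0 l te ok {eB} => //= w b _; rewrite last_rcons => ->.
  rewrite -cats1 tgtp_cat okp_cat /= => _ /andP[ok /andP[/eqP e _]].
  by rewrite (loop_nil acy ok (esym e)).
- have := acy (v := s a) (w := [:: a]); rewrite /= eqxx /= => /(_ isT isT).
  by rewrite -st eqxx.
Qed.

Lemma Z_path a z : z \in Z -> okp s t (s (head a z)) z.
Proof. by move/hZ; case: z => //= b z /andP[]. Qed.

Lemma Z_notin v z : z \in Z -> (v, z) \notin Bs.
Proof.
move=> zZ; rewrite mem_Bseq negb_and negbK orbC.
by apply/orP; left; apply/hasP; exists z => //; exact: infix_refl.
Qed.

(** Not being glued is automatic: otherwise [e] is the arrow [a], and the replacement gives back
    [z], which is outside [B]. *)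
Lemma effective_intro a e z j : parallel (a, e) -> z \in Z -> (j < size z)%N ->
  nth a z j = a -> (s (head a z), replw z j (val e).2) \in Bs ->
  effective (a, e : Bt s t Z).
Proof.
move=> pe zZ jz za rB; rewrite /effective; apply/andP; split; last first.
  apply/hasP; exists z => //; apply/hasP; exists j; first by rewrite mem_iota.
  by rewrite za eqxx.
apply: contraTN rB => /(glued_parallel pe) ->.
by rewrite -{2}za replw_nth // Z_notin.
Qed.

(** In [leib_replw] only replacements of [a] by [e] remain, and each result is outside [B] because
    the pair is not effective. *)
Lemma leib_pair_val x z : x \in ne_pairs s t Z -> z \in Z -> leib (pair_val x) z = 0.
Proof.
case: x => a e; rewrite inE => /andP[pe neff] zZ.
rewrite (leib_replw (pair_val_supported pe) a (Z_path a zZ)).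
rewrite big1 // => j _; rewrite big1 // => i _.
rewrite pair_valE /=; case: eqP => [za|_]; last by rewrite scale0r.
case: eqP => [ei|_]; last by rewrite scale0r.
rewrite pvec0 ?scaler0 //; apply: contraNN neff; rewrite -ei.
exact: effective_intro.
Qed.

Lemma isDer_pair x : x \in ne_pairs s t Z -> isDer (leibD (pair_val x)).
Proof.
move=> xne; apply: isDer_leibD => [|z]; last exact: leib_pair_val.
by apply: pair_val_supported; move: xne; rewrite inE => /andP[].
Qed.

(** * Derivations killing the vertices *)

Section VertexFree.
Variable g : 'End(Lam).
Hypotheses (gD : isDer g) (gv : forall v, g (pvec (v, [::])) = 0).
Let beta a := g (avec a).

(** Apply [g] to an arrow multiplied by its source or target vertex: since [g] kills that vertex,
    the value keeps the same end. *)
Lemma vfree_supported : par_supported beta.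
Proof.
have al a : pvec (s a, [::]) ** avec a = avec a by rewrite mulL_pvec /= eqxx.
have ar a : avec a ** pvec (t a, [::]) = avec a by rewrite mulL_pvec /= eqxx.
move=> a i; rewrite /par negb_and => /orP[/negPf ne|/negPf ne].
  by rewrite /beta -al gD gv mul0L add0r mulL_vl ne mulr0.
by rewrite /beta -ar gD gv mulL0 addr0 mulL_vr ne mulr0.
Qed.

Lemma vfree_leib v w : okp s t v w -> g (pvec (v, w)) = leib beta w.
Proof.
elim: w v => [|a w IH] v ok; first exact: gv.
by case/andP: (ok) => _ ok'; rewrite pvec_cons // gD IH.
Qed.

(** Since [z] is zero in [Lam], so is [leib beta z]. Its coefficient at the replaced path [q] is the
    wanted one, because by [replw_inj] no other replacement produces [q]. *)
Lemma vfree_effective a (e : Bt s t Z) :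
  parallel (a, e) -> effective (a, e) -> beta a 0 (enum_rank e) = 0.
Proof.
move=> pe /andP[_ /hasP[z zZ /hasP[i]]]; rewrite mem_iota /= add0n => iz /andP[/eqP za].
rewrite -/(replw z i (val e).2); set q := (_, _) => qB.
have zok := Z_path a zZ.
have z0 : leib beta z = 0.
  by rewrite -(vfree_leib zok) pvec0 ?linear0 // Z_notin.
have /pthP[l ql] := qB.
have epth : pth (enum_rank e) = val e by rewrite /pth enum_rankK.
have /andP[/eqP e1 /eqP e2] := pe.
have oke : okp s t (s a) (val e).2 by rewrite -e1 -epth okp_pth.
(* The side condition of [replw_inj]: [q] lies in [B] while [z] does not. *)
have qz : replw z i (val e).2 <> z.
  by move=> qe; move: qB; rewrite /q qe (negPf (Z_notin _ zZ)).
move: (z0); rewrite (leib_replw vfree_supported a zok) => /rowP/(_ l).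
rewrite mxE summxE (bigD1 (Ordinal iz)) //= summxE (bigD1 (enum_rank e)) //=.
rewrite mxE pvecE epth -ql eqxx mulr1 za.
have uniq_repl (j : 'I_(size z)) i' : (j, i') != (Ordinal iz, enum_rank e) ->
    (beta (nth a z j) 0 i' *: pvec (s (head a z), replw z j (pth i').2)) 0 l = 0.
  move=> ne; rewrite mxE pvecE -ql.
  case: (boolP (par i' (nth a z j))) => [/andP[/eqP p1 /eqP p2]|/vfree_supported->];
    last by rewrite mul0r.
  case: eqP => [[qe]|_]; last by rewrite mulr0.
  case/eqP: ne.
  have [ji ee] : val j = i /\ (pth i').2 = (val e).2.
    apply: (replw_inj acy zok (ltn_ord j) iz (x0 := a)) => //; rewrite ?za //.
    - by rewrite -p1 okp_pth.
    - by rewrite -p1.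
    - by rewrite -e1.
  congr (_, _); first exact: val_inj.
  apply: pth_inj; rewrite epth [LHS]surjective_pairing [RHS]surjective_pairing ee.
  by rewrite p1 e1 ji za.
rewrite big1 ?addr0; last first.
  move=> i' ne; have := @uniq_repl (Ordinal iz) i'; rewrite /= za; apply.
  by rewrite xpair_eqE eqxx.
rewrite big1 ?addr0 // => j ne; rewrite summxE big1 // => i' _.
by apply: uniq_repl; rewrite xpair_eqE negb_and ne.
Qed.

(** Both sides are Leibniz extensions, so it suffices to expand [beta a] in the basis; coefficients
    of non-parallel or effective pairs vanish. *)
Lemma vfree_comb :
  g = \sum_(x in ne_pairs s t Z) beta x.1 0 (enum_rank x.2) *: leibD (pair_val x).
Proof.
apply: lfun_ext => i; rewrite sum_lfunE.
rewrite [pth i]surjective_pairing vfree_leib ?okp_pth // -surjective_pairing.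
under eq_bigr do rewrite scale_lfunE leibD_pth.
apply: leib_sum => a; apply/rowP => j; rewrite summxE.
under eq_bigr do rewrite mxE pair_valE.
have xj (x : Q1 * Bt s t Z) : x != (a, enum_val j) -> (a == x.1) && (val x.2 == pth j) = false.
  case: x => b e; apply: contraNF => /= /andP[/eqP-> /eqP ej].
  by apply/eqP; congr (_, _); apply: val_inj.
have [ne|nne] := boolP ((a, enum_val j) \in ne_pairs s t Z).
  rewrite (bigD1 (a, enum_val j)) //= !eqxx mulr1 enum_valK big1 ?addr0 //.
  by move=> x /andP[_ /xj->]; rewrite mulr0.
rewrite big1; last first.
  by move=> x xne; rewrite xj ?mulr0 //; apply: contraNneq nne => <-.
move: nne; rewrite inE negb_and negbK -(enum_valK j) enum_rankK => /orP[npar|eff].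
  by apply: vfree_supported; rewrite /par enum_valK; exact: npar.
have [pe|/negP npar] := boolP (parallel (a, enum_val j)).
  exact: vfree_effective.
by apply: vfree_supported; rewrite /par enum_valK; apply/negP; exact: npar.
Qed.
End VertexFree.

(** * Values on vertices, and a basis of the derivations *)

(** By [ad_vertex], this says that on vertices [f] agrees with an inner derivation. It follows from
    idempotency and orthogonality of vertices. *)
Lemma der_vertex (f : 'End(Lam)) v i : isDer f ->
  f (pvec (v, [::])) 0 i =
  f (pvec (tgtp t (pth i).1 (pth i).2, [::])) 0 i *
  ((tgtp t (pth i).1 (pth i).2 == v)%:R - ((pth i).1 == v)%:R).
Proof.
move=> fD.
have vv u : f (pvec (u, [::])) 0 i = f (pvec (u, [::])) 0 i * (tgtp t (pth i).1 (pth i).2 == u)%:R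
     + f (pvec (u, [::])) 0 i * ((pth i).1 == u)%:R.
  have uu : pvec (u, [::]) ** pvec (u, [::]) = pvec (u, [::]) by rewrite mulL_pvec /= eqxx.
  by have /rowP/(_ i) := fD (pvec (u, [::])) (pvec (u, [::])); rewrite uu mxE mulL_vl mulL_vr.
have [i0|i0] := eqVneq (pth i).2 [::].
  (* For a trivial path, idempotency gives either [x = x + x] or [x = 0], in any characteristic. *)
  rewrite i0 /= subrr mulr0; have := vv v; rewrite i0 /=.
  case: eqP => _; rewrite ?mulr1 ?mulr0 ?addr0 // => /eqP.
  by rewrite -subr_eq0 opprD addrA subrr sub0r oppr_eq0 => /eqP.
have tv := tgt_pth i0.
(* The source and target vertices have product [0], so the coefficients at [i] of their images are
   opposite. *)
have sw := fD (pvec ((pth i).1, [::])) (pvec (tgtp t (pth i).1 (pth i).2, [::])).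
move/rowP/(_ i): sw; rewrite mulL_pvec /= tv linear0 !mxE mulL_vl mulL_vr !eqxx !mulr1.
move/esym/eqP; rewrite addr_eq0 => /eqP fs.
have [<-|nt] := eqVneq (tgtp t (pth i).1 (pth i).2) v; first by rewrite tv subr0 mulr1.
have [<-|ns] := eqVneq (pth i).1 v; first by rewrite sub0r mulrN1 fs.
by rewrite vv (negPf nt) (negPf ns) !mulr0 addr0 subrr mulr0.
Qed.

Definition der_gen (j : 'I_n + Q1 * Bt s t Z) : 'End(Lam) :=
  match j with inl i => ad (pvec (pth i)) | inr x => leibD (pair_val x) end.

(** Trivial paths are left out: [ad] of a vertex kills all vertices, so it is a combination of the
    derivations attached to pairs. *)
Definition der_idx (j : 'I_n + Q1 * Bt s t Z) : bool :=
  match j with inl i => (pth i).2 != [::] | inr x => x \in ne_pairs s t Z end.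

Definition derV : {vspace 'End(Lam)} := <<image der_gen der_idx>>%VS.

Lemma card_der_idx : (#|der_idx| + #|Q0| = n + #|ne_pairs s t Z|)%N.
Proof.
transitivity (#|[pred i | (pth i).2 != [::]]| + #|Q0| + #|ne_pairs s t Z|)%N.
  rewrite addnAC; congr (_ + _)%N; rewrite -!sum1_card.
  exact: (@big_sumType _ _ addn _ _ der_idx).
by rewrite card_nontrivial.
Qed.

Lemma sum_ad (P : pred 'I_n) (c : 'I_n -> k) :
  \sum_(i | P i) c i *: ad (pvec (pth i)) = ad (\sum_(i | P i) c i *: pvec (pth i)).
Proof.
rewrite -adLE linear_sum; apply: eq_bigr => i _.
by rewrite linearZ_LR /= adLE.
Qed.

Lemma sum_coef (P : pred 'I_n) (c : 'I_n -> k) i :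
  (\sum_(j | P j) c j *: pvec (pth j)) 0 i = if P i then c i else 0.
Proof.
rewrite summxE; have E j : j != i -> (c j *: pvec (pth j)) 0 i = 0.
  by move=> ji; rewrite mxE pvecE (inj_eq pth_inj) (negPf ji) mulr0.
case: ifP => Pi; last first.
  by rewrite big1 // => j Pj; apply: E; apply: contraFneq Pi => <-.
rewrite (bigD1 i) //= mxE pvecE eqxx mulr1 big1 ?addr0 // => j /andP[_].
exact: E.
Qed.

(** Evaluation at vertices kills the [leibD] terms and isolates the coefficients of paths through
    [ad_tgt]; evaluation at arrows then isolates those of pairs. *)
Lemma dim_derV : \dim derV = #|der_idx|.
Proof.
apply: dim_span_image => c; rewrite big_sumType /= sum_ad.
set x := \sum_(i | _) _ => /= sum0.
have Dv y v : leibD (pair_val y) (pvec (v, [::])) = 0.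
  by rewrite -pth_vidx leibD_pth pth_vidx.
have x0 i : (pth i).2 != [::] -> c (inl i) = 0.
  move=> i0; have := sum_coef [pred i | (pth i).2 != [::]] (c \o inl) i.
  rewrite -/x /= i0 => <-; rewrite -(ad_tgt x i0).
  move/lfunP/(_ (pvec (tgtp t (pth i).1 (pth i).2, [::]))): sum0.
  rewrite add_lfunE sum_lfunE [X in _ + X]big1 ?addr0; first by move=> ->; rewrite lfunE mxE.
  by move=> y _; rewrite scale_lfunE Dv scaler0.
case=> [i /x0//|[a e] ene].
have ad0 : ad x = 0.
  rewrite /x big1 => [|i /x0->]; last by rewrite scale0r.
  by rewrite -adLE linear0.
have /pthP[l al] := arrow_mem a.
move/lfunP/(_ (pvec (pth l)))/rowP/(_ (enum_rank e)): sum0.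
rewrite ad0 add0r sum_lfunE lfunE mxE summxE.
have DE y : y \in ne_pairs s t Z ->
    (c (inr y) *: leibD (pair_val y)) (pvec (pth l)) 0 (enum_rank e)
    = c (inr y) * (y == (a, e))%:R.
  rewrite inE => /andP[py _].
  rewrite scale_lfunE leibD_pth -al /= mulL0 addr0 mxE; congr (_ * _).
  rewrite (par_supported_r _ (pair_val_supported py)) pair_valE /pth enum_rankK.
  by case: y {py} => b f; rewrite xpair_eqE /= val_eqE eq_sym.
rewrite (bigD1 (a, e)) //= DE // eqxx mulr1 big1 ?addr0 // => y /andP[yne ya].
by rewrite DE // (negPf ya) mulr0.
Qed.

Lemma mem_derV f : f \in derV <-> isDer f.
Proof.
split=> [/(coord_span (X := image_tuple _ _)) ->|fD].
  apply: isDer_comb => i _; rewrite /= nth_image.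
  case: (enum_val i) (enum_valP i) => [j _|x]; first exact: isDer_ad.
  exact: isDer_pair.
(* The coefficients dictated by [der_vertex]: subtracting [ad x] leaves a derivation killing the
   vertices, to which [vfree_comb] applies. *)
pose alpha i := f (pvec (tgtp t (pth i).1 (pth i).2, [::])) 0 i.
pose x := \sum_(i | (pth i).2 != [::]) alpha i *: pvec (pth i).
pose g := f - ad x.
have gD : isDer g.
  move=> y z; rewrite /g !add_lfunE !opp_lfunE fD isDer_ad.
  by rewrite mulLDl mulLDr mulNL mulLN opprD addrACA.
have gv v : g (pvec (v, [::])) = 0.
  apply/rowP => i; rewrite /g add_lfunE opp_lfunE mxE [X in _ + X]mxE ad_vertex.
  rewrite (der_vertex v i fD) /x sum_coef mxE /=.
  by have [->|_] := eqVneq (pth i).2 [::]; rewrite /= ?subrr ?mulr0 ?mul0r ?subrr.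
have -> : f = g + ad x by rewrite addrNK.
rewrite (vfree_comb gD gv) /x -sum_ad memvD //; apply: memv_suml => j Pj;
  apply/memvZ/memv_span.
  exact: (image_f der_gen (x := inr j)).
exact: (image_f der_gen (x := inl j)).
Qed.

End Algebra.

(** * The dimension count *)

Theorem theorem5p1 (k : fieldType) (Q0 Q1 : finType) (s t : Q1 -> Q0)
    (Z : seq (seq Q1)) :
  (0 < #|Q0|)%N ->
  connected_quiver s t ->
  acyclic s t ->
  (forall z, z \in Z -> is_arrow_path s t z && (2 <= size z)%N) ->
  minimal_rel Z ->
  exists U V : {vspace 'End(Lam s t Z k)},
    (forall f, f \in U <-> isDer f) /\
    (forall f, f \in V <-> is_inner f) /\
    ((\dim U)%:Z - (\dim V)%:Z
       = 1 - (#|Q0|)%:Z + (#|ne_pairs s t Z|)%:Z)%R.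
Proof.
move=> q0 con acy hZ _; exists (derV s t Z k), (limg (adL s t Z k)); split; [|split].
- exact: mem_derV.
- move=> f; split=> [/memv_imgP[x _ ->]|[x fx]].
    by exists x => y; rewrite adLE // adE.
  apply/memv_imgP; exists x; rewrite ?memvf // adLE //.
  by apply/lfunP => y; rewrite fx adE.
(* Here [m] stands for the cardinality of [B], which cancels between the dimensions of [U] and
   [V]. *)
have dimE (u v q e m : nat) : (u + q = m + e)%N -> v.+1 = m ->
    (u%:Z - v%:Z = 1 - q%:Z + e%:Z)%R by lia.
apply: dimE (dim_inner k acy hZ q0 con).
by rewrite dim_derV //; exact: card_der_idx.
Qed.
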